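(* Let $\pi:L\rightarrow M$ be a coz-onto, dense frame homomorphism. If $L$ is a $P_F$-frame, then so is $M$.
   Context: A frame is a complete lattice $L$ (top $1$, bottom $0$) satisfying $a\wedge\bigvee S=\bigvee\{a\wedge s\mid s\in S\}$ for all $a\in L$, $S\subseteq L$. A frame homomorphism preserves finite meets (including the top) and arbitrary joins (including the bottom). For $a\in L$ the pseudocomplement is $a^*=\bigvee\{x\in L\mid x\wedge a=0\}$, and $a$ is complemented if $a\vee a^*=1$. Write $a\prec b$ if there is $t\in L$ with $a\wedge t=0$ and $t\vee b=1$; write $a\prec\!\prec b$ if there is a family $(c_q)$ indexed by $\mathbb{Q}\cap[0,1]$ with $c_0=a$, $c_1=b$ and $c_r\prec c_s$ whenever $r<s$. $L$ is completely regular if $a=\bigvee\{x\in L\mid x\prec\!\prec a\}$ for all $a\in L$. Throughout, all frames are assumed completely regular. An element $a\in L$ is a cozero element if there is a sequence $(a_n)$ with $a_n\prec\!\prec a$ for each $n$ and $a=\bigvee_n a_n$ (equivalently, $a=\mathrm{coz}\,\varphi$ for some real-valued continuous function $\varphi$ on $L$); $\mathrm{Coz}\,L$ is the set of cozero elements. $L$ is a $P_F$-frame if whenever $a,b\in\mathrm{Coz}\,L$ satisfy $a\wedge b=0$, at least one of $a,b$ is complemented. A frame homomorphism $\pi:L\to M$ is dense if it maps only the bottom element to the bottom element, and coz-onto if for every $c\in\mathrm{Coz}\,M$ there exists $d\in\mathrm{Coz}\,L$ with $\pi(d)=c$. *)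

(* Defs.v *)
From HB Require Import structures.
From mathcomp Require Import all_boot all_order all_algebra.
From mathcomp Require Import boolp classical_sets.

Set Implicit Arguments.
Unset Strict Implicit.
Unset Printing Implicit Defensive.

Import Order.TTheory GRing.Theory Num.Theory.

Local Open Scope classical_set_scope.
Local Open Scope order_scope.

HB.mixin Record isCompleteLattice d L of Order.TBLattice d L := {
  bigjoin : set L -> L;
  bigjoin_ub : forall (S : set L) (x : L), S x -> x <= bigjoin S;
  bigjoin_le : forall (S : set L) (y : L),
    (forall x, S x -> x <= y) -> bigjoin S <= y
}.

#[short(type="completeLatticeType")]
HB.structure Definition CompleteLattice d :=
  {L of Order.TBLattice d L & isCompleteLattice d L}.

HB.mixin Record isFrame d L of CompleteLattice d L := {
  meet_bigjoin : forall (a : L) (S : set L),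
    a `&` bigjoin S = bigjoin [set a `&` s | s in S]
}.

#[short(type="frameType")]
HB.structure Definition Frame d :=
  {L of CompleteLattice d L & isFrame d L}.

(* Preservation of the bottom element is the case S = set0 of the last field. *)
Record frame_hom dL dM (L : frameType dL) (M : frameType dM) (f : L -> M) :
    Prop := FrameHom {
  frame_hom_top : f \top = \top;
  frame_hom_meet : forall a b : L, f (a `&` b) = f a `&` f b;
  frame_hom_bigjoin : forall S : set L, f (bigjoin S) = bigjoin (f @` S)
}.

Section FrameElements.
Context {d : Order.disp_t} {L : frameType d}.
Implicit Types a b x : L.

Definition pseudocompl a : L := bigjoin [set x | x `&` a = \bot].

Definition complemented a : Prop := a `|` pseudocompl a = \top.

Definition rather_below a b : Prop :=
  exists t : L, a `&` t = \bot /\ t `|` b = \top.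

(* The family is indexed by all rationals; its values outside [0, 1] are
   unconstrained. *)
Definition completely_below a b : Prop :=
  exists c : rat -> L,
    [/\ c 0%R = a,
        c 1%R = b &
        forall r s : rat, (0 <= r)%R -> (r < s)%R -> (s <= 1)%R ->
          rather_below (c r) (c s)].

Definition cozero a : Prop :=
  exists u : nat -> L,
    (forall n, completely_below (u n) a) /\ a = bigjoin (range u).

End FrameElements.

Definition completely_regular d (L : frameType d) : Prop :=
  forall a : L, a = bigjoin [set x | completely_below x a].

Definition PF_frame d (L : frameType d) : Prop :=
  forall a b : L, cozero a -> cozero b -> a `&` b = \bot ->
    complemented a \/ complemented b.

Definition dense_map dL dM (L : frameType dL) (M : frameType dM)
  (f : L -> M) : Prop := forall x : L, f x = \bot -> x = \bot.

Definition coz_onto dL dM (L : frameType dL) (M : frameType dM)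
  (f : L -> M) : Prop :=
  forall c : M, cozero c -> exists2 e : L, cozero e & f e = c.

(* Main.v *)
Require Import Defs.
From mathcomp Require Import all_boot all_order.
From mathcomp Require Import classical_sets.

(** Two disjoint cozero elements of [M] lift along [pi] to cozero elements of
    [L]. Density is what makes the lifts disjoint again: their meet is sent to
    bottom, hence is bottom ([dense_disjoint]). The property of [L] then makes
    one of the lifts complemented, and complementedness is expressed by finite
    meets and joins alone, so it is preserved by any frame homomorphism
    ([frame_hom_complemented]). *)

Import Order.TTheory.
Local Open Scope classical_set_scope.
Local Open Scope order_scope.

Lemma bigjoin0 (d : Order.disp_t) (L : frameType d) :
  bigjoin (set0 : set L) = \bot.
Proof. by apply/eqP; rewrite -lex0; apply: bigjoin_le. Qed.

Lemma bigjoin2 (d : Order.disp_t) (L : frameType d) (a b : L) :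
  bigjoin [set a; b] = a `|` b.
Proof.
apply/eqP; rewrite eq_le; apply/andP; split.
  by apply: bigjoin_le => x [->|->]; rewrite ?leUl ?leUr.
by rewrite leUx; apply/andP; split; apply: bigjoin_ub; [left|right].
Qed.

(** The infinite distributive law is what keeps the join of all elements
    disjoint from [a] disjoint from [a]. *)
Lemma meet_pseudocompl (d : Order.disp_t) (L : frameType d) (a : L) :
  a `&` pseudocompl a = \bot.
Proof.
rewrite /pseudocompl meet_bigjoin; apply/eqP; rewrite -lex0.
by apply: bigjoin_le => _ [x /= xa0 <-]; rewrite meetC xa0.
Qed.

(** Frame homomorphisms need not preserve pseudocomplements,
    but they do preserve the two equations on [t]. *)
Lemma complementedP (d : Order.disp_t) (L : frameType d) (a : L) :
  complemented a <-> exists t : L, a `&` t = \bot /\ a `|` t = \top.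
Proof.
split=> [aT|[t [at0 atT]]].
  by exists (pseudocompl a); split; [exact: meet_pseudocompl|].
apply/eqP; rewrite -le1x -atT; apply: leU2 => //.
by apply: bigjoin_ub; rewrite /= meetC.
Qed.

Section FrameHom.
Context {dL dM : Order.disp_t} {L : frameType dL} {M : frameType dM}.
Context (f : L -> M) (f_hom : frame_hom f).

Lemma frame_hom_bot : f \bot = \bot.
Proof. by rewrite -bigjoin0 (frame_hom_bigjoin f_hom) image_set0 bigjoin0. Qed.

Lemma frame_hom_join (a b : L) : f (a `|` b) = f a `|` f b.
Proof.
by rewrite -bigjoin2 (frame_hom_bigjoin f_hom) image_setU !image_set1 bigjoin2.
Qed.

Lemma frame_hom_complemented (a : L) : complemented a -> complemented (f a).
Proof.
move=> /complementedP[t [at0 atT]]; apply/complementedP; exists (f t).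
rewrite -(frame_hom_meet f_hom) at0 frame_hom_bot.
by rewrite -frame_hom_join atT (frame_hom_top f_hom).
Qed.

Lemma dense_disjoint (f_dense : dense_map f) (a b : L) :
  f a `&` f b = \bot -> a `&` b = \bot.
Proof. by move=> fab0; apply: f_dense; rewrite (frame_hom_meet f_hom). Qed.

End FrameHom.

Theorem proposition4p1 (dL dM : Order.disp_t)
  (L : frameType dL) (M : frameType dM)
  (L_creg : completely_regular L) (M_creg : completely_regular M)
  (pi : L -> M) (pi_hom : frame_hom pi)
  (pi_coz_onto : coz_onto pi) (pi_dense : dense_map pi)
  (L_PF : PF_frame L) :
  PF_frame M.
Proof.
move=> _ _ /pi_coz_onto[a coz_a <-] /pi_coz_onto[b coz_b <-] pi_ab0.
have ab0 := dense_disjoint _ pi_hom pi_dense _ _ pi_ab0.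
by case: (L_PF a b coz_a coz_b ab0) => compl; [left|right];
  exact: frame_hom_complemented.
Qed.
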